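(* Let $X,Y$ be real topological-linear spaces, $\Omega\subseteq X$ nonempty, $f:X\to Y$, $\psi:Y\to\mathbb R$ a seminorm with $\psi\not\equiv0$, and $\varphi:Y\to\mathbb R$ a sublinear functional with $\varphi(0)=0$. Let $(x^*,\alpha)\in Y^*\times\mathbb R_+$ be such that $C:=C_\psi(x^*,\alpha)$ satisfies $C\neq\ell(C)$ and $\varphi$ is $-C$ representing. Then, for any $\bar x\in\Omega$, the following assertions are equivalent: (1°) $\bar x\in\mathrm{Eff}(\Omega\mid f,C)$. (2°) For any $k\in C\setminus\ell(C)$, the set $\{(x,0)\mid x\in\Omega,\ f(x)=f(\bar x)\}$ is the set of solutions of $(P_\varphi^{a,k})$ for $a=f(\bar x)$. (3°) $\{x\in\Omega\mid f(x)=f(\bar x)\}=\operatorname{argmin}_{x\in\Omega}\varphi(f(x)-f(\bar x))$. If there are sets $\mathcal P\subseteq Y$, $\mathcal T\subseteq C\setminus\ell(C)$ and $\mathcal R\subseteq\mathbb R$ such that $f[\mathrm{Eff}(\Omega\mid f,C)]\subseteq\mathcal P+\mathcal R\cdot\mathcal T$, then (1°)–(3°) are equivalent to: (4°) There are $a\in\mathcal P$, $k\in\mathcal T$ and $s\in\mathcal R$ so that $\{(x,s)\mid x\in\Omega,\ f(x)=f(\bar x)\}$ is the set of solutions of $(P_\varphi^{a,k})$. If further $C$ is closed, then (1°)–(4°) are equivalent to: (5°) There are $a\in\mathcal P$, $k\in\mathcal T$ and $s\in\mathcal R$ so that $\varphi^G_{a-C,k}(f(\bar x))=s$ and $\{x\in\Omega\mid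 f(x)=f(\bar x)\}=\operatorname{argmin}_{x\in\Omega}\varphi^G_{a-C,k}(f(x))$.
   Context: $Y^*$ is the topological dual of $Y$, $\mathbb R_+=[0,\infty)$. $C_\psi(x^*,\alpha):=\{y\in Y\mid x^*(y)\ge\alpha\psi(y)\}$ (Bishop-Phelps type cone). For a cone $C$: $\ell(C):=C\cap(-C)$; $\varphi$ is $-C$ representing if $-C=\{y\in Y\mid\varphi(y)\le0\}$. $\mathrm{Eff}(\Omega\mid f,C)$ is the set of $\bar x\in\Omega$ for which there is no $x\in\Omega$ with $f(x)\in f(\bar x)-(C\setminus\{0\})$. $f[D]$ is the image of $D$ under $f$. For $a,k\in Y$, $(P_\varphi^{a,k})$ is the problem: minimize $\lambda$ subject to $\varphi(f(x)-a-\lambda k)\le0$, $(x,\lambda)\in\Omega\times\mathbb R$; a solution is a feasible pair $(x,\lambda)$ with $\lambda$ minimal among all feasible pairs. $\varphi^G_{a-C,k}(y):=\inf\{t\in\mathbb R\mid y\in tk+(a-C)\}\in\mathbb R\cup\{\pm\infty\}$ ($\inf\emptyset=+\infty$). *)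

(* Defs.v *)
From HB Require Import structures.
From mathcomp Require Import all_boot all_order all_algebra.
From mathcomp Require Import boolp classical_sets reals ereal constructive_ereal.
From mathcomp Require Import topology normedtype tvs.

Set Implicit Arguments.
Unset Strict Implicit.
Unset Printing Implicit Defensive.

Import Order.TTheory GRing.Theory Num.Theory.
Import numFieldNormedType.Exports.

Local Open Scope classical_set_scope.
Local Open Scope ring_scope.

Definition seminorm (R : realType) (Y : lmodType R) (psi : Y -> R) : Prop :=
  [/\ forall y, 0 <= psi y,
      forall (t : R) y, psi (t *: y) = `|t| * psi y &
      forall y z, psi (y + z) <= psi y + psi z].

(* Homogeneity is only required for t > 0, so phi 0 = 0 is not part of the
   notion. *)
Definition sublinear (R : realType) (Y : lmodType R) (phi : Y -> R) : Prop :=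
  (forall (t : R) y, 0 < t -> phi (t *: y) = t * phi y) /\
  (forall y z, phi (y + z) <= phi y + phi z).

Definition bishop_phelps_cone (R : realType) (Y : lmodType R)
    (psi : Y -> R) (xs : Y -> R) (alpha : R) : set Y :=
  [set y | alpha * psi y <= xs y].

Definition oppset (Y : zmodType) (C : set Y) : set Y := [set - c | c in C].

Definition lineality (Y : zmodType) (C : set Y) : set Y := C `&` oppset C.

Definition representing (R : realType) (Y : lmodType R)
    (phi : Y -> R) (A : set Y) : Prop :=
  A = [set y | phi y <= 0].

Definition Eff (X : Type) (Y : zmodType)
    (Omega : set X) (f : X -> Y) (C : set Y) : set X :=
  [set xb | Omega xb /\
     ~ (exists2 x, Omega x & [set f xb - c | c in C `\ 0] (f x))].

Definition argmin (X : Type) (d : Order.disp_t) (V : porderType d)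
    (A : set X) (h : X -> V) : set X :=
  [set x | A x /\ forall z, A z -> (h x <= h z)%O].

Definition scal_feasible (R : realType) (X : Type) (Y : lmodType R)
    (Omega : set X) (f : X -> Y) (phi : Y -> R) (a k : Y) : set (X * R) :=
  [set xl | Omega xl.1 /\ phi (f xl.1 - a - xl.2 *: k) <= 0].

Definition scal_solutions (R : realType) (X : Type) (Y : lmodType R)
    (Omega : set X) (f : X -> Y) (phi : Y -> R) (a k : Y) : set (X * R) :=
  argmin (scal_feasible Omega f phi a k) snd.

(* The Gerstewitz functional of A in direction k; it is used with A := a - C. *)
Definition gerstewitz (R : realType) (Y : lmodType R)
    (A : set Y) (k y : Y) : \bar R :=
  ereal_inf [set t%:E | t in [set t : R | [set t *: k + b | b in A] y]].

(* Main.v *)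
(* Every scalarization below compares f x with f xb through the single relation
   f xb - f x \in C. Moving f xb along a direction k in C \ l(C) keeps it in
   f x + C only in the increasing direction, so that efficiency pins the optimal
   parameter. A Bishop-Phelps cone is always algebraically closed along lines
   (by the triangle inequality for psi), hence the infimum defining the
   Gerstewitz functional is attained even without topological closedness. *)
Require Import Defs.
From HB Require Import structures.
From mathcomp Require Import all_boot all_order all_algebra.
From mathcomp Require Import boolp classical_sets reals ereal constructive_ereal.
From mathcomp Require Import topology normedtype tvs.
From mathcomp Require Import lra.

Set Implicit Arguments.
Unset Strict Implicit.
Unset Printing Implicit Defensive.

Import Order.TTheory GRing.Theory Num.Theory.
Import numFieldNormedType.Exports.

Local Open Scope classical_set_scope.
Local Open Scope ring_scope.

(** * Convex cones and closedness along a direction *)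

Definition convex_cone (R : realType) (Y : lmodType R) (C : set Y) : Prop :=
  [/\ C 0, forall y z, C y -> C z -> C (y + z) &
      forall (t : R) y, 0 < t -> C y -> C (t *: y)].

Definition directionally_closed (R : realType) (Y : lmodType R)
    (C : set Y) (k : Y) : Prop :=
  forall y, (forall e : R, 0 < e -> C (y + e *: k)) -> C y.

Lemma subr_telescope (Y : zmodType) (a b c d : Y) :
  a - c + d = b - c + (a - b + d).
Proof. by rewrite addrA [b - c + _]addrC [a - b + _]addrA subrK. Qed.

(** With [a + s *: k = f xb], this moves the base point from [a] to [f xb] at the price of replacing
    the parameter [t] by [t - s]. *)
Lemma subr_scaler_shift (R : realType) (Y : lmodType R) (a y k : Y) (s t : R) :
  a - y + t *: k = a + s *: k - y + (t - s) *: k.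
Proof. by rewrite [a + _ - y]addrAC -[RHS]addrA -scalerDl [s + _]addrC subrK. Qed.

Lemma oppsetE (Y : zmodType) (C : set Y) (y : Y) : oppset C y <-> C (- y).
Proof.
split=> [[c Cc <-]|Cy]; first by rewrite opprK.
by exists (- y); rewrite ?opprK.
Qed.

Lemma bishop_phelps_convex_cone (R : realType) (Y : lmodType R)
    (psi : Y -> R) (xs : {scalar Y}) (alpha : R) :
  seminorm psi -> 0 <= alpha -> convex_cone (bishop_phelps_cone psi xs alpha).
Proof.
move=> [psi_ge0 psiZ psiD] alpha_ge0; rewrite /bishop_phelps_cone; split=> /=.
- by rewrite -[in psi _](scale0r 0) psiZ normr0 mul0r mulr0 linear0.
- move=> y z Cy Cz; rewrite linearD /=.
  apply: le_trans (lerD Cy Cz); rewrite -mulrDr.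
  exact: ler_wpM2l.
- move=> t y t0 Cy; rewrite linearZ /= psiZ gtr0_norm // mulrCA.
  by rewrite ler_pM2l.
Qed.

(** Moving from [y + d *: k] back to [y] worsens the defining inequality by at most [d * B], which
    is made smaller than any given [e]. *)
Lemma bishop_phelps_directionally_closed (R : realType) (Y : lmodType R)
    (psi : Y -> R) (xs : {scalar Y}) (alpha : R) (k : Y) :
  seminorm psi -> 0 <= alpha ->
  directionally_closed (bishop_phelps_cone psi xs alpha) k.
Proof.
move=> [psi_ge0 psiZ psiD] alpha_ge0 y; rewrite /bishop_phelps_cone /= => Cy.
set B := `|xs k| + alpha * psi k.
have B0 : 0 <= B by rewrite addr_ge0 // mulr_ge0.
apply/ler_addgt0Pr => e e0.
(* [B] may vanish, hence the denominator [B + 1]. *)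
have d0 : 0 < e / (B + 1) by rewrite divr_gt0 // ltr_wpDl.
have dB : e / (B + 1) * B <= e.
  by rewrite -mulrA ler_piMr ?(ltW e0)// mulrC ler_pdivrMr ?ltr_wpDl// mul1r lerDl.
move: d0 dB (Cy _ d0); set d := e / _ => d0 dB; rewrite linearD linearZ /= => Cyd.
(* Triangle inequality for [y] written as [(y + d *: k) + (- d) *: k]. *)
have psiy : psi y <= psi (y + d *: k) + d * psi k.
  have := psiD (y + d *: k) ((- d) *: k).
  by rewrite psiZ normrN gtr0_norm // -addrA -scalerDl subrr scale0r addr0.
have := ler_wpM2l alpha_ge0 psiy; rewrite mulrDr.
have := ler_norm (xs k) => xk; have := ler_wpM2l (ltW d0) xk.
move: dB; rewrite /B mulrDr mulrCA; lra.
Qed.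

Lemma convex_cone_le (R : realType) (Y : lmodType R) (C : set Y) (k y : Y)
    (s t : R) :
  convex_cone C -> C k -> s <= t -> C (y + s *: k) -> C (y + t *: k).
Proof.
move=> [_ CD CZ] Ck; rewrite le_eqVlt => /predU1P[->//|st] Cy.
have -> : y + t *: k = y + s *: k + (t - s) *: k.
  by rewrite -addrA -scalerDl [s + _]addrC subrK.
by apply: CD => //; apply: CZ => //; rewrite subr_gt0.
Qed.

(** * Efficient points *)

Lemma EffP (R : realType) (X : Type) (Y : lmodType R) (Omega : set X)
    (f : X -> Y) (C : set Y) (xb : X) :
  Omega xb ->
  Eff Omega f C xb <->
  (forall x, Omega x -> C (f xb - f x) -> f x = f xb).
Proof.
move=> Oxb; split=> [[_ nE] x Ox Cx|E].
  apply: contrapT => nfx; apply: nE; exists x => //.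
  exists (f xb - f x); last by rewrite subKr.
  by split=> //= /subr0_eq/esym.
split=> // -[x Ox [c [Cc /= c0] fx]]; apply: c0.
have cE : c = f xb - f x by rewrite -fx subKr.
by rewrite cE (E x Ox) -?cE // subrr.
Qed.

(** Raising [t] to 0 stays in [C], so efficiency gives [f x = f xb]. What remains is [t *: k] in
    [C]; were [t] negative, rescaling would put [- k] in [C], against the choice of [k] outside the
    lineality space. *)
Lemma Eff_shift (R : realType) (X : Type) (Y : lmodType R) (Omega : set X)
    (f : X -> Y) (C : set Y) (xb x : X) (k : Y) (t : R) :
  convex_cone C -> (C `\` lineality C) k -> Eff Omega f C xb -> Omega x ->
  t <= 0 -> C (f xb - f x + t *: k) -> f x = f xb /\ t = 0.
Proof.
move=> Ccone [Ck Lk] E Ox t0 Cx; have [Oxb _] := E.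
have fx : f x = f xb.
  have /(EffP _ _ Oxb) := E; apply=> //.
  by have := convex_cone_le Ccone Ck t0 Cx; rewrite scale0r addr0.
split=> //; apply/eqP; rewrite eq_le t0 /= leNgt; apply/negP => tlt0.
apply: Lk; split=> //; apply/oppsetE.
have [_ _ CZ] := Ccone.
(* The factor [(- t)^-1] turns [t *: k] into [- k]. *)
have := CZ (- t)^-1 _ _ Cx; rewrite invr_gt0 oppr_gt0 => /(_ tlt0).
by rewrite fx subrr add0r scalerA invrN mulNr mulVf ?lt_eqF // scaleN1r.
Qed.

(** * Scalarization by the constrained problem *)

Lemma scal_feasibleP (R : realType) (X : Type) (Y : lmodType R)
    (Omega : set X) (f : X -> Y) (phi : Y -> R) (C : set Y) (a k : Y)
    (x : X) (l : R) :
  representing phi (oppset C) ->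
  scal_feasible Omega f phi a k (x, l) <->
  Omega x /\ C (a - f x + l *: k).
Proof.
move=> rep; have phiE y : phi y <= 0 <-> C (- y).
  have -> : (phi y <= 0) = oppset C y :> Prop by rewrite rep.
  exact: oppsetE.
have -> : a - f x + l *: k = - (f x - a - l *: k) by rewrite !opprB addrC.
by rewrite -phiE.
Qed.

(** Recentred at [f xb], a feasible pair of value [l <= s] meets the hypotheses of [Eff_shift] with
    shift [l - s]; hence no value lies below [s], and [s] is reached only where [f x = f xb]. *)
Lemma Eff_scal_solutions (R : realType) (X : Type) (Y : lmodType R)
    (Omega : set X) (f : X -> Y) (phi : Y -> R) (C : set Y) (a k : Y)
    (xb : X) (s : R) :
  convex_cone C -> representing phi (oppset C) -> (C `\` lineality C) k ->
  f xb = a + s *: k -> Eff Omega f C xb ->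
  [set (x, s) | x in [set x | Omega x /\ f x = f xb]] =
  scal_solutions Omega f phi a k.
Proof.
move=> Ccone rep Ck fxb E; have [C0 _ _] := Ccone; have [Oxb _] := E.
have feasE x l : scal_feasible Omega f phi a k (x, l) <->
    Omega x /\ C (f xb - f x + (l - s) *: k).
  by rewrite (scal_feasibleP _ _ _ _ _ _ rep) fxb -subr_scaler_shift.
have feasxb x : Omega x -> f x = f xb -> scal_feasible Omega f phi a k (x, s).
  by move=> Ox fx; apply/feasE; rewrite fx !subrr scale0r addr0.
apply/seteqP; split=> [_ [x [Ox fx] <-]|[x l] [Fx minx]].
  split=> [|[z l] /feasE[/= Oz Cz]]; first exact: feasxb.
  rewrite leNgt; apply/negP => ls.
  have ls0 : l - s <= 0 by rewrite subr_le0 ltW.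
  have [_ /subr0_eq lE] := Eff_shift Ccone Ck E Oz ls0 Cz.
  by rewrite lE ltxx in ls.
have /= ls := minx _ (feasxb xb Oxb erefl).
move/feasE: Fx => [/= Ox Cx]; rewrite -subr_le0 in ls.
by have [fx /subr0_eq ->] := Eff_shift Ccone Ck E Ox ls Cx; exists x.
Qed.

(** If [f xb - f x] is in [C], adding it to the constraint satisfied by [(xb, s)] makes [(x, s)]
    feasible with the same minimal value. It is then a solution, which forces [f x = f xb]. *)
Lemma scal_solutions_Eff (R : realType) (X : Type) (Y : lmodType R)
    (Omega : set X) (f : X -> Y) (phi : Y -> R) (C : set Y) (a k : Y)
    (xb : X) (s : R) :
  convex_cone C -> representing phi (oppset C) -> Omega xb ->
  [set (x, s) | x in [set x | Omega x /\ f x = f xb]] =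
  scal_solutions Omega f phi a k ->
  Eff Omega f C xb.
Proof.
move=> [_ CD _] rep Oxb solE; apply/EffP => // x Ox Cx.
have [/(scal_feasibleP _ _ _ _ _ _ rep)[_ Cxb] minxb] :
    scal_solutions Omega f phi a k (xb, s) by rewrite -solE; exists xb.
suff : scal_solutions Omega f phi a k (x, s).
  by rewrite -solE => -[z [_ fz] [<-]].
split=> //; apply/(scal_feasibleP _ _ _ _ _ _ rep); split=> //.
by rewrite (subr_telescope _ (f xb)); exact: CD.
Qed.

(** * Scalarization by the Gerstewitz functional *)

Lemma gerstewitz_le (R : realType) (Y : lmodType R) (C : set Y) (a k y : Y)
    (t : R) :
  C (a - y + t *: k) -> (gerstewitz [set (a - c)%R | c in C] k y <= t%:E)%E.
Proof.
move=> Cy; apply: ereal_inf_lbound; exists t => //=.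
exists (a - (a - y + t *: k)); first by exists (a - y + t *: k).
by rewrite -[a - y + _]addrA opprD addNKr opprD opprK addrC subrK.
Qed.

Lemma gerstewitz_ge (R : realType) (Y : lmodType R) (C : set Y) (a k y : Y)
    (m : \bar R) :
  (forall t : R, C (a - y + t *: k) -> (m <= t%:E)%E) ->
  (m <= gerstewitz [set (a - c)%R | c in C] k y)%E.
Proof.
move=> mt; apply/ereal_infP => _ [t [_ [c Cc <-] ytc] <-]; apply: mt.
by rewrite -ytc opprD addrA [a - _ - _]addrAC subrK subKr.
Qed.

(** The parameters [t] with [a - y + t *: k] in [C] form an upper set. If [s + e] were not among
    them, it would bound the infimum from below, contradicting the bound [s]; directional closedness
    then lets [e] tend to 0. *)
Lemma gerstewitz_attained (R : realType) (Y : lmodType R) (C : set Y)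
    (a k y : Y) (s : R) :
  convex_cone C -> C k -> directionally_closed C k ->
  (gerstewitz [set (a - c)%R | c in C] k y <= s%:E)%E -> C (a - y + s *: k).
Proof.
move=> Ccone Ck Cclosed Gs; apply: Cclosed => e e0; rewrite -addrA -scalerDl.
apply: contrapT => nC.
have : ((s + e)%:E <= gerstewitz [set (a - c)%R | c in C] k y)%E.
  apply: gerstewitz_ge => t Ct; rewrite lee_fin leNgt; apply/negP => tse.
  exact/nC/(convex_cone_le Ccone Ck (ltW tse)).
by move=> /le_trans/(_ Gs); rewrite lee_fin -subr_ge0 opprD addNKr oppr_ge0 leNgt e0.
Qed.

Lemma Eff_argmin_gerstewitz (R : realType) (X : Type) (Y : lmodType R)
    (Omega : set X) (f : X -> Y) (C : set Y) (a k : Y) (xb : X) (s : R) :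
  convex_cone C -> directionally_closed C k -> (C `\` lineality C) k ->
  f xb = a + s *: k -> Eff Omega f C xb ->
  gerstewitz [set a - c | c in C] k (f xb) = s%:E /\
  [set x | Omega x /\ f x = f xb] =
  argmin Omega (fun x => gerstewitz [set a - c | c in C] k (f x)).
Proof.
move=> Ccone Cclosed Ck fxb E; have [C0 _ _] := Ccone; have [Oxb _] := E.
have shiftE x t : a - f x + t *: k = f xb - f x + (t - s) *: k.
  by rewrite fxb; exact: subr_scaler_shift.
have Gge x : Omega x -> (s%:E <= gerstewitz [set (a - c)%R | c in C] k (f x))%E.
  move=> Ox; apply: gerstewitz_ge => t; rewrite shiftE lee_fin => Ct.
  rewrite leNgt; apply/negP => ts.
  have ts0 : t - s <= 0 by rewrite subr_le0 ltW.
  have [_ /subr0_eq tE] := Eff_shift Ccone Ck E Ox ts0 Ct.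
  by rewrite tE ltxx in ts.
have Gxb : gerstewitz [set a - c | c in C] k (f xb) = s%:E.
  apply/eqP; rewrite eq_le Gge // andbT; apply: gerstewitz_le.
  by rewrite shiftE !subrr scale0r addr0.
split=> //; apply/seteqP; split=> x [Ox].
  by move=> fx; split=> // z Oz; rewrite fx Gxb; exact: Gge.
(* A minimizer has value at most [s]; attainment turns this into a membership in [C], to which
   [Eff_shift] applies with the zero shift [s - s]. *)
move=> /(_ _ Oxb); rewrite Gxb.
move=> /(gerstewitz_attained Ccone Ck.1 Cclosed); rewrite shiftE => Cx.
split=> //; have ss : s - s <= 0 by rewrite subrr.
by have [] := Eff_shift Ccone Ck E Ox ss Cx.
Qed.

(** The functional is monotone for the order of [C]: every [t] admissible for [f xb] is admissible
    for a dominating [f x], so [x] is a minimizer too. *)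
Lemma argmin_gerstewitz_Eff (R : realType) (X : Type) (Y : lmodType R)
    (Omega : set X) (f : X -> Y) (C : set Y) (a k : Y) (xb : X) :
  convex_cone C -> Omega xb ->
  [set x | Omega x /\ f x = f xb] =
  argmin Omega (fun x => gerstewitz [set a - c | c in C] k (f x)) ->
  Eff Omega f C xb.
Proof.
move=> [_ CD _] Oxb solE; apply/EffP => // x Ox Cx.
have [_ minxb] :
    argmin Omega (fun x => gerstewitz [set a - c | c in C] k (f x)) xb.
  by rewrite -solE.
suff : argmin Omega (fun x => gerstewitz [set a - c | c in C] k (f x)) x.
  by rewrite -solE => -[].
split=> // z Oz; apply: le_trans (minxb z Oz).
apply: gerstewitz_ge => t Ct; apply: gerstewitz_le.
by rewrite (subr_telescope _ (f xb)); exact: CD.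
Qed.

(** * Scalarization by the representing functional *)

Lemma Eff_argmin_representing (R : realType) (X : Type) (Y : lmodType R)
    (Omega : set X) (f : X -> Y) (phi : Y -> R) (C : set Y) (xb : X) :
  phi 0 = 0 -> representing phi (oppset C) -> Omega xb ->
  Eff Omega f C xb <->
  [set x | Omega x /\ f x = f xb] =
  argmin Omega (fun x => phi (f x - f xb)).
Proof.
move=> phi0 rep Oxb; rewrite (EffP _ _ Oxb).
have phiE x : phi (f x - f xb) <= 0 <-> C (f xb - f x).
  have -> : (phi (f x - f xb) <= 0) = oppset C (f x - f xb) :> Prop.
    by rewrite rep.
  by rewrite oppsetE opprB.
split=> [E|solE x Ox /phiE phix].
  apply/seteqP; split=> x [Ox].
    move=> fx; split=> // z Oz; rewrite fx subrr phi0 leNgt; apply/negP => phiz.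
    (* A negative value would make [z] dominate [xb], so [f z = f xb] and the value is [phi 0 = 0]
       after all. *)
    by move: (phiz); rewrite (E z Oz) ?subrr ?phi0 ?ltxx //; exact/phiE/ltW.
  by move=> /(_ _ Oxb); rewrite subrr phi0 => /phiE /(E x Ox).
have [_ minxb] : argmin Omega (fun x => phi (f x - f xb)) xb by rewrite -solE.
suff : argmin Omega (fun x => phi (f x - f xb)) x by rewrite -solE => -[].
split=> // z Oz; apply: le_trans (minxb z Oz).
by rewrite subrr phi0.
Qed.

Theorem proposition17 (R : realType) (X Y : topologicalLmodType R)
    (Omega : set X) (Omega0 : Omega !=set0) (f : X -> Y)
    (psi : Y -> R) (psi_seminorm : seminorm psi)
    (psi_neq0 : exists y, psi y <> 0)
    (phi : Y -> R) (phi_sublinear : sublinear phi) (phi0 : phi 0 = 0)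
    (xs : {scalar Y}) (xs_continuous : continuous (xs : Y -> R))
    (alpha : R) (alpha_ge0 : 0 <= alpha) :
  let C : set Y := bishop_phelps_cone psi xs alpha in
  C <> lineality C ->
  representing phi (oppset C) ->
  forall xb : X, Omega xb ->
  [/\ Eff Omega f C xb <->
      (forall k, (C `\` lineality C) k ->
        [set (x, 0 : R) | x in [set x | Omega x /\ f x = f xb]] =
        scal_solutions Omega f phi (f xb) k),
      Eff Omega f C xb <->
      [set x | Omega x /\ f x = f xb] =
        argmin Omega (fun x => phi (f x - f xb)) &
      forall (Ps Ts : set Y) (Rs : set R),
        Ts `<=` C `\` lineality C ->
        f @` Eff Omega f C `<=`
          [set p + v | p in Ps & v in [set r *: t | r in Rs & t in Ts]] ->
        (Eff Omega f C xb <->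
          exists a k s, [/\ Ps a, Ts k, Rs s &
            [set (x, s) | x in [set x | Omega x /\ f x = f xb]] =
            scal_solutions Omega f phi a k]) /\
        (closed C ->
          (Eff Omega f C xb <->
            exists a k s, [/\ Ps a, Ts k, Rs s,
              gerstewitz [set a - c | c in C] k (f xb) = s%:E &
              [set x | Omega x /\ f x = f xb] =
              argmin Omega
                (fun x => gerstewitz [set a - c | c in C] k (f x))]))].
Proof.
move=> C CneqL rep xb Oxb.
have Ccone : convex_cone C by exact: bishop_phelps_convex_cone.
have Cclosed k : directionally_closed C k.
  exact: bishop_phelps_directionally_closed.
split.
- split=> [E k Ck|solE].
    by apply: (Eff_scal_solutions Ccone rep Ck _ E); rewrite scale0r addr0.
  (* Without such a direction the second assertion would hold vacuously; [CneqL] provides one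
     because the lineality space is contained in [C]. *)
  have [k Ck] : exists k, (C `\` lineality C) k.
    apply: contrapT => nk; apply: CneqL; apply/seteqP; split=> [k Ck|k []//].
    by apply: contrapT => Lk; apply: nk; exists k.
  exact: (scal_solutions_Eff Ccone rep Oxb (solE k Ck)).
- exact: Eff_argmin_representing.
- move=> Ps Ts Rs TsC fE; split=> [|_].
    split=> [E|[a [k [s [_ _ _ solE]]]]]; last
      exact: (scal_solutions_Eff Ccone rep Oxb solE).
    (* The inclusion hypothesis, applied to the efficient value [f xb], supplies [a], [s] and [k]
       with [f xb = a + s *: k]. *)
    have [|a Pa [_ [s Rs_s [k Tk <-]] fxb]] := fE (f xb); first by exists xb.
    exists a, k, s; split=> //.
    exact: (Eff_scal_solutions Ccone rep (TsC _ Tk) (esym fxb) E).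
  split=> [E|[a [k [s [_ _ _ _ solE]]]]]; last
    exact: (argmin_gerstewitz_Eff Ccone Oxb solE).
  have [|a Pa [_ [s Rs_s [k Tk <-]] fxb]] := fE (f xb); first by exists xb.
  have [Gs solE] :=
    Eff_argmin_gerstewitz Ccone (Cclosed k) (TsC _ Tk) (esym fxb) E.
  by exists a, k, s.
Qed.
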